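(* Let $\kappa\ge2$, $\lambda\ge0$ and $\tau$ be integers such that $\chi(J)\le\tau$ for every $\lambda$-spread digraph $J$ with $\omega(J)<\kappa$. Then there exists $c_0$ such that $\chi(G)\le c_0$ for every acyclic $\lambda$-spread digraph $G$ with $\omega(G)\le\kappa$.
   Context: Digraphs are finite, with no loops, parallel edges or antiparallel pairs; $G^*$ is the underlying undirected graph and $\chi,\omega$ refer to $G^*$. A digraph is acyclic if it has no directed cycle. $N^+(v)$, $N^-(v)$ are the out- and in-neighbourhoods of $v$. A digraph $G$ is $\lambda$-spread if for every vertex $v$ and all $A\subseteq N^+(v)$, $B\subseteq N^-(v)$ with $|A|=|B|=\lambda$, some vertex of $A$ is $G^*$-adjacent with some vertex of $B$. *)

(* Defs.v *)
From mathcomp Require Import all_boot.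
Set Implicit Arguments. Unset Strict Implicit. Unset Printing Implicit Defensive.

(* A digraph on a finite vertex type T is an arc relation E : rel T.
   Parallel arcs are impossible for a relation; we require no loops and
   no antiparallel pairs. *)
Definition is_digraph (T : finType) (E : rel T) : Prop :=
  (forall x, ~~ E x x) /\ (forall x y, E x y -> ~~ E y x).

Definition uadj (T : finType) (E : rel T) (x y : T) : bool := E x y || E y x.

Definition outN (T : finType) (E : rel T) (v : T) : {set T} := [set y | E v y].
Definition inN (T : finType) (E : rel T) (v : T) : {set T} := [set y | E y v].

Definition acyclic (T : finType) (E : rel T) : Prop :=
  forall c : seq T, c != [::] -> ~~ cycle E c.

Definition spread (lam : nat) (T : finType) (E : rel T) : Prop :=
  forall (v : T) (A B : {set T}),
    A \subset outN E v -> B \subset inN E v -> #|A| = lam -> #|B| = lam ->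
    exists a b, [/\ a \in A, b \in B & uadj E a b].

Definition is_clique (T : finType) (E : rel T) (S : {set T}) : Prop :=
  forall x y, x \in S -> y \in S -> x != y -> uadj E x y.

Definition clique_lt (T : finType) (E : rel T) (k : nat) : Prop :=
  forall S : {set T}, is_clique E S -> #|S| < k.
Definition clique_le (T : finType) (E : rel T) (k : nat) : Prop :=
  forall S : {set T}, is_clique E S -> #|S| <= k.

Definition colorable (T : finType) (E : rel T) (k : nat) : Prop :=
  exists f : T -> 'I_k, forall x y, uadj E x y -> f x != f y.

(* Main.v *)
Require Import Defs.
From mathcomp Require Import all_boot.
(** Fix d > kappa * lam and choose d in-neighbours B(v) of each vertex v. By
    spreadness, for all but boundedly many out-neighbours w of v fewer than lam
    members of B(v) fail to be in-neighbours of w; by acyclicity the arcs to the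
    exceptional out-neighbours form a digraph of bounded degeneracy, so boundedly
    many colours make them all bichromatic. The vertices of indegree less than d
    are also boundedly colourable. Repeating this inside each colour class, with
    B(v) chosen in that class, yields nested levels; after kappa rounds every
    surviving vertex is the sink of a clique of size kappa + 1, so none
    survives. *)

Set Implicit Arguments. Unset Strict Implicit. Unset Printing Implicit Defensive.

(** Rank a vertex by how many vertices reach it. Along an arc from [x] to [y] this set gains [y],
    since a path from [y] back to [x] would close a directed cycle. *)
Lemma acyclic_rank (T : finType) (E : rel T) :
  acyclic E -> exists h : T -> nat, forall x y, E x y -> h x < h y.
Proof.
move=> acE; exists (fun v => #|[set w | connect E w v]|) => x y Exy.
apply/proper_card/properP; split.
  by apply/subsetP=> w; rewrite !inE => /connect_trans; apply; apply: connect1.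
exists y; rewrite !inE ?connect0 //.
apply/negP=> /connectP[p Ep xp].
by have /negP[] := acE (y :: p) isT; rewrite /= rcons_path Ep -xp.
Qed.

Lemma exists_subset_card (T : finType) (A : {set T}) n :
  n <= #|A| -> exists2 B : {set T}, B \subset A & #|B| = n.
Proof.
move=> /card_geqP[s [Us sz sA]]; exists [set x in s].
  by apply/subsetP=> x; rewrite inE => /sA.
by rewrite cardsE -sz; apply/card_uniqP.
Qed.

Lemma card_bigcup_le (T I : finType) (P : {pred I}) (F : I -> {set T}) n :
  (forall i, P i -> #|F i| <= n) -> #|\bigcup_(i | P i) F i| <= #|P| * n.
Proof.
move=> leF; rewrite -sum_nat_const.
elim/big_rec2: _ => [|i s A Pi IH]; first by rewrite cards0.
by rewrite (leq_trans (leq_card_setU _ _)) // leq_add ?leF.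
Qed.

(** [D] may be asymmetric, so that sets of arcs can be coloured. Colours are naturals bounded on [W]
    only, which lets palettes be shifted and merged. *)
Definition colorable_on (T : finType) (D : rel T) (W : {set T}) (n : nat) :=
  exists2 f : T -> nat, (forall x, x \in W -> f x < n) &
    forall x y, x \in W -> y \in W -> D x y -> f x != f y.

Lemma colorable_on_sym (T : finType) (D : rel T) (W : {set T}) n :
  colorable_on D W n -> colorable_on (fun x y => D y x) W n.
Proof.
by move=> [f f_lt fP]; exists f => // x y xW yW Dyx; rewrite eq_sym fP.
Qed.

Lemma colorable_onU (T : finType) (D : rel T) (V W : {set T}) m n :
  colorable_on D V m -> colorable_on D W n -> colorable_on D (V :|: W) (m + n).
Proof.
move=> [f f_lt fP] [g g_lt gP].
exists (fun x => if x \in V then f x else m + g x) => [x|x y].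
  rewrite inE; case: ifP => /= [xV _|_ xW]; first exact/ltn_addr/f_lt.
  by rewrite ltn_add2l g_lt.
rewrite !inE; case: ifP => xV; case: ifP => yV //= xW yW Dxy.
- exact: fP.
- by rewrite neq_ltn ltn_addr ?f_lt.
- by rewrite neq_ltn (ltn_addr (g x) (f_lt _ yV)) orbT.
- by rewrite eqn_add2l gP.
Qed.

Lemma colorable_on_fibers (T : finType) (D : rel T) (W : {set T})
    (g : T -> nat) m n :
  (forall x, x \in W -> g x < m) ->
  (forall i, colorable_on D [set x in W | g x == i] n) ->
  colorable_on D W (m * n).
Proof.
move=> g_lt colg.
have -> : W = [set x in W | g x < m].
  by apply/setP=> x; rewrite inE andb_idr //; apply: g_lt.
elim: m {g_lt} => [|m IHm]; first by exists (fun=> 0) => x; rewrite inE ltn0 andbF.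
have -> : [set x in W | g x < m.+1] =
          [set x in W | g x == m] :|: [set x in W | g x < m].
  by apply/setP=> x; rewrite !inE ltnS leq_eqVlt andb_orr.
by rewrite mulSn; apply: colorable_onU.
Qed.

(** Colour a vertex of [W] of maximal [h] last: no arc of [D] enters it from [W], so only its at
    most [m] out-neighbours restrict its colour. *)
Lemma greedy_coloring (T : finType) (D : rel T) (h : T -> nat) (W : {set T}) m :
  (forall x y, D x y -> h y < h x) ->
  (forall x, x \in W -> #|[set y in W | D x y]| <= m) ->
  colorable_on D W m.+1.
Proof.
move=> hD; elim: {W}_.+1 {-2}W (ltnSn #|W|) => // s IH W sW degW.
have [->|[x0 x0W]] := set_0Vmem W; first by exists (fun=> 0) => x; rewrite inE.
have [v vW hv] : exists2 v, v \in W & forall x, x \in W -> h x <= h v.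
  by case: (arg_maxnP h x0W) => v; exists v.
have [|x|f f_lt fP] := IH (W :\ v).
- by rewrite (cardsD1 v W) vW add1n ltnS in sW.
- rewrite inE => /andP[_ xW]; apply: leq_trans (degW x xW).
  by apply/subset_leq_card/subsetP=> y; rewrite !inE -andbA => /andP[].
pose C := [seq f y | y in [set y in W | D v y]].
have [c c_lt cC] : exists2 c, c < m.+1 & c \notin C.
  have [/hasP[c]|/hasPn noc] := boolP (has (fun c => c \notin C) (iota 0 m.+1)).
    by rewrite mem_iota => /andP[_ c_lt] cC; exists c.
  have /(uniq_leq_size (iota_uniq 0 m.+1)) : {subset iota 0 m.+1 <= C}.
    by move=> c /noc/negPn.
  by rewrite size_iota size_map -cardE ltnNge degW.
exists (fun x => if x == v then c else f x) => [x xW|x y xW yW Dxy] /=.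
  by case: eqP => // /eqP xv; apply: f_lt; rewrite !inE xv.
have Dirr z : ~~ D z z by apply/negP=> /hD; rewrite ltnn.
have [xv|xv] := eqVneq x v; have [yv|yv] := eqVneq y v.
- by rewrite xv yv (negPf (Dirr v)) in Dxy.
- by apply: contraNneq cC => ->; apply/imageP; exists y; rewrite // inE yW -xv.
- by have := hv x xW; rewrite leqNgt -yv (hD _ _ Dxy).
- by apply: fP; rewrite // !inE ?xv ?yv.
Qed.

Section Spread.

Variables (T : finType) (E : rel T) (h : T -> nat) (lam kappa d : nat).
Hypothesis hE : forall x y, E x y -> h x < h y.
Hypothesis spreadE : spread lam E.

Fixpoint level (k : nat) (W : {set T}) : Prop :=
  if k is k'.+1 then exists V : {set T}, [/\ level k' V, W \subset V &
    exists B : T -> {set T},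
      (forall v, v \in W -> B v \subset V :&: inN E v /\ #|B v| = d) /\
      (forall u v, u \in W -> v \in W -> E u v -> #|B u :\: inN E v| < lam)]
  else True.

(* The clique grows downwards: [x] is its source, and as each [s] in [S] misses
   fewer than [lam] elements of [B x], some [b] in [B x] dominates all of [S]. *)
Lemma level_clique k W (x : T) (S : {set T}) :
  kappa * lam < d -> clique_le E kappa ->
  level k W -> S \subset W -> x \in S -> is_clique E S ->
  (forall s, s \in S -> s != x -> E x s) ->
  #|S| + k <= kappa.
Proof.
move=> d_gt cliqE; elim: k W x S => [|k IH] W x S.
  by rewrite addn0 => *; apply: cliqE.
move=> /= [V [levV WV [B [BP Bexc]]]] SW xS cS xmin.
have [BxV cardB] := BP x (subsetP SW x xS).
have [b bB bS] : exists2 b, b \in B x & forall s, s \in S -> E b s.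
  (* [X] collects what the other clique members miss. There are at most [kappa] of them, each
     missing at most [lam] elements, so [d > kappa * lam] leaves some [b]. *)
  pose X := \bigcup_(s in S :\ x) (B x :\: inN E s).
  have X_lt : #|X| < #|B x|.
    rewrite cardB (leq_ltn_trans _ d_gt) //.
    apply: leq_trans (_ : #|S :\ x| * lam <= _).
      apply: card_bigcup_le => s; rewrite !inE => /andP[sx sS].
      by apply/ltnW/Bexc; rewrite ?xmin // (subsetP SW).
    by rewrite leq_mul2r (leq_trans (subset_leq_card (subsetDl _ _))) ?orbT ?cliqE.
  have [|b bB bX] := @subsetPn _ (B x) X _.
    by apply: contraL X_lt => /subset_leq_card; rewrite -leqNgt.
  exists b => // s sS; have [->|sx] := eqVneq s x.
    by have := subsetP BxV b bB; rewrite !inE => /andP[].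
  apply: contraNT bX => nbs; apply/bigcupP; exists s; first by rewrite !inE sx.
  by rewrite !inE bB nbs.
have bNS : b \notin S by apply/negP=> /bS/hE; rewrite ltnn.
have := IH V b (b |: S); rewrite cardsU1 bNS add1n addSnnS; apply=> //.
- rewrite subUset sub1set (subset_trans SW WV) andbT.
  by have := subsetP BxV b bB; rewrite inE => /andP[].
- by rewrite setU11.
- move=> y z; rewrite !inE => /predU1P[->|yS] /predU1P[->|zS] yz.
  + by rewrite eqxx in yz.
  + by rewrite /uadj bS.
  + by rewrite /uadj bS ?orbT.
  + exact: cS.
- by move=> s; rewrite !inE => /predU1P[->|/bS//]; rewrite eqxx.
Qed.

(** Charge each exceptional [w] to a [lam]-subset [S] of [B] that it misses. If [lam] such vertices
    shared [S], spreadness would join one of them, [a], to some [b] in [S]; as [b] does not dominate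
    [a], the arc goes from [a] to [b] and closes the cycle [b], [v], [a]. *)
Lemma card_exceptional (v : T) (B : {set T}) :
  B \subset inN E v ->
  #|[set w in outN E v | lam <= #|B :\: inN E w|]| <= 2 ^ #|B| * lam.
Proof.
move=> Bv; rewrite -card_powerset.
pose F (S : {set T}) := [set w in outN E v | S \subset B :\: inN E w].
pose P := [set S in powerset B | #|S| == lam].
apply: leq_trans (_ : #|\bigcup_(S in P) F S| <= _).
  apply/subset_leq_card/subsetP=> w; rewrite inE => /andP[vw].
  move=> /exists_subset_card[S SB cS]; apply/bigcupP; exists S.
    by rewrite !inE cS eqxx andbT (subset_trans SB) ?subsetDl.
  by rewrite inE vw.
apply: leq_trans (_ : #|P| * lam <= _); last first.
  rewrite leq_mul2r subset_leq_card ?orbT //.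
  by apply/subsetP=> S; rewrite inE => /andP[].
apply: card_bigcup_le => S; rewrite !inE => /andP[SB /eqP cS].
rewrite leqNgt; apply/negP=> /ltnW/exists_subset_card[A AF cA].
have [|a [b [aA bS]]] := spreadE _ (subset_trans SB Bv) cA cS.
  by apply/subsetP=> a /(subsetP AF); rewrite inE => /andP[].
have := subsetP AF a aA; rewrite !inE => /andP[va /subsetP/(_ b bS)].
rewrite !inE => /andP[/negPf nba bB]; rewrite /uadj nba orbF => /hE.
have := subsetP Bv b bB; rewrite inE => /hE bv; move/hE: va => va.
by rewrite ltnNge (ltnW (ltn_trans bv va)).
Qed.

Lemma level_coloring k n :
  (forall W, level k.+1 W -> colorable_on E W n) ->
  forall W, level k W -> colorable_on E W (d.+1 + (2 ^ d * lam).+1 * n).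
Proof.
move=> IH W levW.
pose L := [set v in W | #|W :&: inN E v| < d].
rewrite -(setID W L); apply: colorable_onU.
  (* Here in-degrees are small, so the greedy colouring is run on reversed arcs. *)
  apply: (@colorable_on_sym _ (fun x y => E y x)).
  apply: (greedy_coloring (h := h)) => [x y /hE //|x]; rewrite !inE => /and3P[_ _ /ltnW le_d].
  apply: leq_trans le_d; apply/subset_leq_card/subsetP=> y.
  by rewrite !inE -!andbA => /and4P[-> _ _ ->].
set U := W :\: L.
have exB v : exists B : {set T}, v \in U -> B \subset W :&: inN E v /\ #|B| = d.
  have [|_] := boolP (v \in U); last by exists set0.
  rewrite !inE => /andP[+ vW]; rewrite vW -leqNgt => /exists_subset_card[B BW cB].
  by exists B.
have [B BP] := fin_all_exists exB.
pose D u v := E u v && (lam <= #|B u :\: inN E v|).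
(* For the exceptional arcs [D] it is out-degrees that are bounded, and [h] grows along arcs, so the
   rank is flipped. *)
have [x y||g g_lt gP] := @greedy_coloring _ D (fun v => \max_x h x - h v) U (2 ^ d * lam).
- by case/andP=> /hE xy _; rewrite ltn_sub2l // (leq_trans xy) // leq_bigmax.
- move=> x /BP[]; rewrite subsetI => /andP[_ Bx] cB.
  rewrite -cB; apply: leq_trans (card_exceptional Bx).
  by apply/subset_leq_card/subsetP=> y; rewrite !inE => /andP[].
apply: (colorable_on_fibers g_lt) => i; apply: IH.
exists W; split => //.
  by apply/subsetP=> x; rewrite !inE => /andP[/andP[]].
exists B; split=> [v|u v]; rewrite inE => /andP[vU /eqP gv]; first exact: BP.
rewrite inE => /andP[wU /eqP gw] uv; rewrite ltnNge.
by apply/negP=> exc; have := gP _ _ vU wU; rewrite /D uv exc gv gw eqxx; move/(_ isT).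
Qed.

End Spread.

Theorem theorem3p3 (kappa lam tau : nat) :
  2 <= kappa ->
  (forall (T : finType) (J : rel T),
      is_digraph J -> spread lam J -> clique_lt J kappa -> colorable J tau) ->
  exists c0 : nat,
    forall (T : finType) (G : rel T),
      is_digraph G -> acyclic G -> spread lam G -> clique_le G kappa ->
      colorable G c0.
Proof.
move=> _ _; pose d := (kappa * lam).+1.
pose c := iter kappa (fun n => d.+1 + (2 ^ d * lam).+1 * n) 0.
exists c => T G _ /acyclic_rank[h hG] spG cliqG.
(* [j] counts the rounds still to come. With none left zero colours suffice: a vertex of [W] would
   be a one-element clique at level [kappa], giving [1 + kappa <= kappa]. *)
have col j : j <= kappa -> forall W, level G lam d (kappa - j) W ->
    colorable_on G W (iter j (fun n => d.+1 + (2 ^ d * lam).+1 * n) 0).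
  elim: j => [_ W|j IH lt_j W]; last first.
    by apply: (level_coloring hG spG); rewrite -subSn // subSS; apply/IH/ltnW.
  rewrite subn0 => levW; have [->|[x xW]] := set_0Vmem W.
    by exists (fun=> 0) => x; rewrite inE.
  suff: #|[set x]| + kappa <= kappa by rewrite cards1 ltnn.
  apply: (level_clique hG (ltnSn _) cliqG levW (x := x)); rewrite ?sub1set ?set11 //.
    by move=> y z; rewrite !inE => /eqP-> /eqP->; rewrite eqxx.
  by move=> s; rewrite inE => ->.
have [|f f_lt fP] := col _ (leqnn _) [set: T]; first by rewrite subnn.
have f_ltc x : f x < c by apply: f_lt.
exists (fun x => Ordinal (f_ltc x)) => x y.
by rewrite -val_eqE /= => /orP[|] xy; [|rewrite eq_sym]; apply: fP.
Qed.
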